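(* For any integer $n\ge 4$, there exist a graph $G=(M,E)$ with $n>\Delta(G)$ and a family of valuations $V$ such that the problem instance $([n],M,V,G)$ does not admit any EF1 allocation.
   Context: A problem instance is a quadruple $(N,M,V,G)$, where $N$ is a finite set of $n$ agents, $M$ is a finite set of $m$ items, $V$ is a family of additive valuation functions $v_i:2^M\to\mathbb{R}_{\ge 0}$, $i\in N$ (write $v_{ij}=v_i(\{j\})$), and $G=(M,E)$ is an undirected (simple) conflict graph on the items. Here $[n]=\{1,\dots,n\}$. An allocation is an ordered partition $A=\langle A_i\rangle_{i\in N}$ of all of $M$ into $|N|$ (possibly empty) bundles; it is feasible if every bundle is an independent set of $G$. A feasible allocation $A$ is EF1 (envy-free up to one good) if for all $i,i'\in N$ with $A_{i'}\neq\emptyset$, $v_i(A_i)\ge v_i(A_{i'})-\max_{j\in A_{i'}}v_{ij}$. $\Delta(G)$ is the maximum degree of $G$. *)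

(* Defs.v *)
From HB Require Import structures.
From mathcomp Require Import all_boot all_order all_algebra.
From mathcomp Require Import reals.

Set Implicit Arguments.
Unset Strict Implicit.
Unset Printing Implicit Defensive.

Import Order.TTheory GRing.Theory Num.Theory.
Local Open Scope ring_scope.

Record sgraph (M : finType) := SGraph {
  edge : rel M;
  edge_sym : symmetric edge;
  edge_irrefl : irreflexive edge
}.

Definition degree (M : finType) (G : sgraph M) (x : M) : nat :=
  #|[set y | edge G x y]|.

Definition max_degree (M : finType) (G : sgraph M) : nat :=
  (\max_(x : M) degree G x)%N.

Definition independent (M : finType) (G : sgraph M) (S : {set M}) : Prop :=
  forall x y : M, x \in S -> y \in S -> ~~ edge G x y.

Record valuation (R : realType) (M : finType) := Valuation {
  value :> {set M} -> R;
  value_ge0 : forall S : {set M}, 0 <= value S;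
  value_additive : forall S : {set M}, value S = \sum_(j in S) value [set j]
}.

(* Bundles are indexed by agents and may be empty, so [partition] from finset,
   which excludes empty blocks, does not apply. *)
Definition allocation (N M : finType) (A : N -> {set M}) : Prop :=
  (forall i i' : N, i != i' -> [disjoint A i & A i']) /\
  \bigcup_(i : N) A i = [set: M].

Definition feasible (N M : finType) (G : sgraph M) (A : N -> {set M}) : Prop :=
  allocation A /\ forall i : N, independent G (A i).

(* The default value 0 of the iterated maximum is harmless: item values are
   nonnegative and the maximum is only taken over nonempty bundles. *)
Definition EF1 (R : realType) (N M : finType) (V : N -> valuation R M)
    (G : sgraph M) (A : N -> {set M}) : Prop :=
  feasible G A /\
  forall i i' : N, A i' != set0 ->
    V i (A i) >= V i (A i') - \big[Num.max/0]_(j in A i') V i [set j].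

(* Main.v *)
Require Import Defs.
From mathcomp Require Import all_boot all_order all_algebra.
From mathcomp Require Import reals.
From mathcomp Require Import lra zify.

(** The counterexample is the complete bipartite graph [K_{3,n-1}] with identical
    valuations: each of the three left items is worth 2, each of the [n-1] right
    items is worth 3.  A bundle lies on one side.  If two right items share a
    bundle, then at least two agents have no right item, and one of them has at
    most one left item: its value is at most 2, but the bundle with two right
    items is still worth at least 3 after a removal.  If no two right items
    share a bundle, a single agent holds all left items, worth 4 after a removal,
    whereas each other agent has a single right item, worth 3. *)

Set Implicit Arguments.
Unset Strict Implicit.
Unset Printing Implicit Defensive.

Import Order.TTheory GRing.Theory Num.Theory.
Local Open Scope ring_scope.

Section CompleteBipartite.
Variables S T : finType.

Definition is_left (x : S + T) : bool := if x is inl _ then true else false.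

Definition bipartite_edge (x y : S + T) : bool := is_left x != is_left y.

Lemma bipartite_edge_sym : symmetric bipartite_edge.
Proof. by move=> x y; rewrite /bipartite_edge eq_sym. Qed.

Lemma bipartite_edge_irrefl : irreflexive bipartite_edge.
Proof. by move=> x; rewrite /bipartite_edge eqxx. Qed.

Definition complete_bipartite : sgraph (S + T)%type :=
  SGraph bipartite_edge_sym bipartite_edge_irrefl.

Lemma max_degree_complete_bipartite :
  (max_degree complete_bipartite <= maxn #|S| #|T|)%N.
Proof.
apply/bigmax_leqP => -[s|t] _; rewrite /degree leq_max.
- apply/orP; right; rewrite -(card_imset predT (@inr_inj S T)).
  by apply/subset_leq_card/subsetP => -[s'|t']; rewrite !inE // => _; apply: imset_f.
- apply/orP; left; rewrite -(card_imset predT (@inl_inj S T)).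
  by apply/subset_leq_card/subsetP => -[s'|t']; rewrite !inE // => _; apply: imset_f.
Qed.

End CompleteBipartite.

Section WeightValuation.
Variables (R : realType) (M : finType) (w : M -> R).
Hypothesis w_ge0 : forall x, 0 <= w x.

Definition weight (X : {set M}) : R := \sum_(j in X) w j.

Lemma weight_ge0 X : 0 <= weight X.
Proof. exact: sumr_ge0. Qed.

Lemma weight1 x : weight [set x] = w x.
Proof. exact: big_set1. Qed.

Lemma weight_additive X : weight X = \sum_(j in X) weight [set j].
Proof. by apply: eq_bigr => j _; rewrite weight1. Qed.

Definition weight_valuation : valuation R M := Valuation weight_ge0 weight_additive.

Lemma weight_const (X : {set M}) c :
  (forall x, x \in X -> w x = c) -> weight X = c * #|X|%:R.
Proof. by move=> wX; rewrite /weight (eq_bigr _ wX) sumr_const mulr_natr. Qed.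

(** With equal weights [c] inside [A i'], removing the best item costs at most [c], so EF1 reduces
    to a linear inequality in the two cardinalities. *)
Lemma EF1_weight_const (N : finType) (G : sgraph M) (A : N -> {set M}) i i' c d :
  EF1 (fun=> weight_valuation) G A -> (0 < #|A i'|)%N ->
  (forall x, x \in A i -> w x = d) -> (forall x, x \in A i' -> w x = c) ->
  c * #|A i'|%:R - c <= d * #|A i|%:R.
Proof.
move=> [_ /(_ i i')] ef; rewrite card_gt0 => nz wi wi'.
move: (ef nz); rewrite /= (weight_const wi) (weight_const wi'); apply: le_trans.
rewrite lerD2l lerN2; apply/bigmax_leP; split.
  (* The default 0 of the iterated maximum must also be bounded by [c]; this holds because [c] is
     the weight of an actual item. *)
  by case/set0Pn: nz => x /wi' <-.
by move=> j /wi' <-; rewrite weight1.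
Qed.

End WeightValuation.

(** Encoding the allocation by an owner function lets agents be counted through images and
    injectivity of [f]. *)
Lemma allocation_owner (N M : finType) (A : N -> {set M}) :
  allocation A -> exists f : M -> N, forall x i, (x \in A i) = (f x == i).
Proof.
move=> [dis cov].
have /fin_all_exists [f fP] x : exists i, x \in A i.
  have : x \in \bigcup_i A i by rewrite cov.
  by case/bigcupP => i _; exists i.
exists f => x i; apply/idP/eqP => [xi|<- //].
apply/eqP; apply: contraT => /dis /disjointFr /(_ (fP x)).
by rewrite xi.
Qed.

Section Counterexample.
Variables (R : realType) (m : nat).

Definition item_weight (x : 'I_3 + 'I_m) : R := if is_left x then 2 else 3.

Lemma item_weight_ge0 x : 0 <= item_weight x.
Proof. by case: x => ? /=; lra. Qed.

Lemma no_EF1_K3m (A : 'I_m.+1 -> {set 'I_3 + 'I_m}) : (0 < m)%N ->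
  ~ EF1 (fun=> weight_valuation item_weight_ge0)
      (complete_bipartite 'I_3 'I_m) A.
Proof.
move=> m_gt0 ef; have [[alloc indep] _] := ef.
have [f fP] := allocation_owner alloc.
have sep x y : f (inl x) != f (inr y).
  apply/eqP => fxy; have := indep (f (inl x)) (inl x) (inr y).
  by rewrite !fP fxy eqxx => /(_ isT isT).
pose rights : {set 'I_m.+1} := [set f (inr y) | y : 'I_m].
have right_bundle y x : x \in A (f (inr y)) -> item_weight x = 3.
  by case: x => // x; rewrite fP (negbTE (sep x y)).
have left_bundle k x : k \notin rights -> x \in A k -> x \in inl @: 'I_3.
  case: x => [x _ _|y kN]; first exact: imset_f.
  by rewrite fP => /eqP yk; case/negP: kN; rewrite -yk; apply: imset_f.
have left_weight k x : k \notin rights -> x \in A k -> item_weight x = 2.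
  by move=> kN /(left_bundle _ _ kN) /imsetP[z _ ->].
have card_left : #|[set (inl x : 'I_3 + 'I_m) | x : 'I_3]| = 3%N.
  by rewrite card_imset ?card_ord //; apply: inl_inj.
have card_rights := cardsC rights; rewrite card_ord in card_rights.
case: (boolP (injectiveb (f \o inr)))
  => [/injectiveP finj|/injectivePn [y [y' yNy' fyy']]].
(* Injectivity gives [m] agents with a right item out of [m.+1], leaving exactly one agent for all
   the left items. *)
- have /cards1P[i Ni] : #|~: rights| == 1%N.
    have : #|rights| = m by rewrite card_imset ?card_ord.
    lia.
  have iN : i \notin rights by rewrite -in_setC Ni set11.
  have Ai : A i = [set inl x | x : 'I_3].
    apply/eqP; rewrite eqEsubset; apply/andP; split.
      by apply/subsetP => x; apply: left_bundle.
    apply/subsetP => _ /imsetP[x _ ->]; rewrite fP -in_set1 -Ni inE.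
    by apply/imsetP => -[y _ /eqP]; rewrite (negbTE (sep x y)).
  pose y0 := Ordinal m_gt0.
  have Ay0 : A (f (inr y0)) = [set inr y0].
    apply/setP => -[x|y]; rewrite fP inE; first by rewrite (negbTE (sep x y0)).
    exact: (inj_eq finj).
  have Ai_gt0 : (0 < #|A i|)%N by rewrite Ai card_left.
  (* The owner of [y0] envies [i]: EF1 would give [2 * 3 - 2 <= 3 * 1]. *)
  have := EF1_weight_const ef Ai_gt0 (right_bundle y0) (left_weight i ^~ iN).
  by rewrite Ai card_left Ay0 cards1; lra.
- have rights_lt : (#|rights| < m)%N.
    rewrite ltn_neqAle -[X in (_ != X)](card_ord m) -[X in (_ <= X)%N](card_ord m).
    rewrite leq_imset_card andbT; apply/negP => /imset_injP inj.
    by move/eqP: yNy'; apply; apply: inj.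
  have /card_gt1P[k1 [k2 [k1N k2N k12]]] : (1 < #|~: rights|)%N by lia.
  rewrite !in_setC in k1N k2N.
  (* [k1] and [k2] have disjoint bundles inside the three left items, so one of them gets at most
     one. *)
  have [k [kN Ak]] : exists k, k \notin rights /\ (#|A k| <= 1)%N.
    have : (#|A k1| + #|A k2| <= 3)%N.
      rewrite -cardsUI (disjoint_setI0 (alloc.1 _ _ k12)) cards0 addn0.
      rewrite -[leqRHS]card_left.
      apply/subset_leq_card/subsetP => x.
      by rewrite inE => /orP[]; apply: left_bundle.
    by have [|] := leqP #|A k1| 1; [exists k1 | exists k2; split=> //; lia].
  have two : (2 <= #|A (f (inr y))|)%N.
    apply/card_gt1P; exists (inr y), (inr y'); rewrite !fP eqxx.
    by move: fyy' => /= ->; rewrite eqxx.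
  (* Agent [k] envies the owner of [y] and [y']: the left side is at least [3 * 2 - 3], the right
     side at most 2. *)
  have := EF1_weight_const ef (ltnW two) (left_weight k ^~ kN) (right_bundle y).
  move: Ak two; rewrite -(ler_nat R) -[(2 <= _)%N](ler_nat R); lra.
Qed.

End Counterexample.

Theorem proposition3 (R : realType) (n : nat) (hn : (4 <= n)%N) :
  exists (M : finType) (G : sgraph M) (V : 'I_n -> valuation R M),
    (max_degree G < n)%N /\
    ~ (exists A : 'I_n -> {set M}, EF1 V G A).
Proof.
(* Here [m] is [n - 1], and [4 <= n] gives [3 <= m], so the degree bound [maxn 3 m] equals [m], just
   below [n]. *)
case: n hn => // m hm.
exists ('I_3 + 'I_m)%type, (complete_bipartite 'I_3 'I_m),
  (fun=> weight_valuation (@item_weight_ge0 R m)); split.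
  apply: leq_ltn_trans (max_degree_complete_bipartite _ _) _.
  by rewrite !card_ord ltnS geq_max leqnn andbT.
by move=> [A]; apply: no_EF1_K3m; exact: (@leq_trans 3).
Qed.
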